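(* Let $\mathcal{C}$ be a polyhedral complex in $\mathbb{R}^n$, let $F:|\mathcal{C}|\to\mathbb{R}$ be affine-linear on each cell of $\mathcal{C}$, and let $[a,b]$ be an interval of transversal thresholds for $F$ on $\mathcal{C}$. Then for every $c\in[a,b]$, the set $\{x\in|\mathcal{C}|:F(x)\le c\}$ is homotopy equivalent to $\{x\in|\mathcal{C}|:F(x)\le a\}$, and $\{x\in|\mathcal{C}|:F(x)\ge c\}$ is homotopy equivalent to $\{x\in|\mathcal{C}|:F(x)\ge b\}$.
   Context: A polyhedral set in $\mathbb{R}^n$ is an intersection of finitely many closed affine half-spaces. A face of a polyhedral set $P$ is $\emptyset$, $P$, or $P\cap H$ for a hyperplane $H$ meeting $P$ with $P$ contained in one closed half-space of $H$. A polyhedral complex is a finite set $\mathcal{C}$ of polyhedral sets (cells) such that every face of a cell is a cell and any two cells intersect in a common face; $|\mathcal{C}|$ is the union of its cells. For $F:|\mathcal{C}|\to\mathbb{R}$ affine-linear on each cell, a cell $C$ is flat if $F$ is constant on $C$ (all $0$-cells are flat). A closed interval $[a,b]$ is an interval of transversal thresholds for $F$ on $\mathcal{C}$ if no flat cell $C$ of $\mathcal{C}$ has $F(C)\subseteq[a,b]$. *)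

(* Defs.v *)
From HB Require Import structures.
From mathcomp Require Import all_boot all_order all_algebra.
From mathcomp Require Import all_classical all_reals all_analysis.
Set Implicit Arguments. Unset Strict Implicit. Unset Printing Implicit Defensive.
Import Order.TTheory GRing.Theory Num.Theory.
Import numFieldNormedType.Exports.
Local Open Scope classical_set_scope.
Local Open Scope ring_scope.

Section Defs.
Variables (R : realType) (n : nat).
Local Notation V := 'rV[R]_n.

Definition dotv (u x : V) : R := \sum_(i < n) u ord0 i * x ord0 i.

Definition halfspace (u : V) (beta : R) : set V := [set x | dotv u x <= beta].
Definition hyperplane (u : V) (beta : R) : set V := [set x | dotv u x = beta].

Definition polyhedral (P : set V) : Prop :=
  exists s : seq (V * R)%type,
    (forall h, h \in s -> h.1 != 0) /\
    P = [set x | forall h, h \in s -> halfspace h.1 h.2 x].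

Definition face (P G : set V) : Prop :=
  G = set0 \/ G = P \/
  exists (u : V) (beta : R), u != 0 /\
    (P `&` hyperplane u beta !=set0) /\
    (P `<=` halfspace u beta \/ P `<=` halfspace (- u) (- beta)) /\
    G = P `&` hyperplane u beta.

Definition polyhedral_complex (CC : set (set V)) : Prop :=
  finite_set CC /\
  (forall C, CC C -> polyhedral C) /\
  (forall C G, CC C -> face C G -> CC G) /\
  (forall C D, CC C -> CC D -> face C (C `&` D) /\ face D (C `&` D)).

Definition support (CC : set (set V)) : set V := \bigcup_(C in CC) C.

Definition cellwise_affine (CC : set (set V)) (F : V -> R) : Prop :=
  forall C, CC C -> exists (u : V) (beta : R),
    forall x, C x -> F x = dotv u x + beta.

Definition flat_cell (CC : set (set V)) (F : V -> R) (C : set V) : Prop :=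
  CC C /\ C !=set0 /\ (forall x y, C x -> C y -> F x = F y).

Definition transversal_thresholds (CC : set (set V)) (F : V -> R) (a b : R) :=
  ~ (exists C, flat_cell CC F C /\ F @` C `<=` [set` `[a, b]%R]).

Definition sublevel (CC : set (set V)) (F : V -> R) (c : R) : set V :=
  [set x | support CC x /\ F x <= c].
Definition superlevel (CC : set (set V)) (F : V -> R) (c : R) : set V :=
  [set x | support CC x /\ c <= F x].

Definition homotopic_on (A B : set V) (f g : V -> V) : Prop :=
  exists H : (R * V)%type -> V,
    {within [set p : (R * V)%type | [set` `[0, 1]%R] p.1 /\ A p.2], continuous H} /\
    (forall t x, [set` `[0, 1]%R] t -> A x -> B (H (t, x))) /\
    (forall x, A x -> H (0, x) = f x) /\
    (forall x, A x -> H (1, x) = g x).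

Definition homotopy_equivalent (A B : set V) : Prop :=
  exists f g : V -> V,
    {within A, continuous f} /\ f @` A `<=` B /\
    {within B, continuous g} /\ g @` B `<=` A /\
    homotopic_on A A (g \o f) id /\ homotopic_on B B (f \o g) id.

End Defs.

(* Main.v *)
(** If a cell [C] contains a point with value in [[a, b]], then [F] exceeds [b]
    somewhere on [C]: otherwise some face of [C] would be flat with value in
    [[a, b]].  Hence [C] has a relatively interior point [q] with [F q > c], and
    pushing the points of [C] with [F <= c] radially away from [q] decreases
    [F], so each of them reaches the level [a] or the relative boundary of [C]
    in finite time.  Stopping there gives a strong deformation retraction that
    is the identity on the proper faces of [C].  Removing the cells one at a
    time, always a maximal one, collapses the sublevel set of [c] onto that of
    [a].  Superlevel sets are sublevel sets of [- F]. *)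
Require Import Defs.
From HB Require Import structures.
From mathcomp Require Import all_boot all_order all_algebra.
From mathcomp Require Import all_classical all_reals all_analysis.
From mathcomp Require Import ring lra.
Import Order.TTheory GRing.Theory Num.Theory.
Import numFieldNormedType.Exports.
Local Open Scope classical_set_scope.
Local Open Scope ring_scope.

(** * Strong deformation retractions and their composition *)

Section Deformation.
Set Implicit Arguments.
Unset Strict Implicit.
Variables (R : realType) (n : nat).
Local Notation V := 'rV[R]_n.
Implicit Types (A B C : set V).

Definition cylinder A : set (R * V)%type :=
  [set p | [set` `[0, 1]%R] p.1 /\ A p.2].

(* Parametrised as [homotopic_on]: time [1] is the identity, time [0] the retraction. *)
Definition strong_deformation_retract A B : Prop :=
  B `<=` A /\ exists H : (R * V)%type -> V,
    [/\ {within cylinder A, continuous H},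
        forall (t : R) x, [set` `[0, 1]%R] t -> A x -> A (H (t, x)),
        forall x, A x -> B (H (0, x)),
        forall x, A x -> H (1, x) = x &
        forall (t : R) x, [set` `[0, 1]%R] t -> B x -> H (t, x) = x].

Lemma strong_deformation_retract_refl A : strong_deformation_retract A A.
Proof.
split=> //; exists snd; split=> //.
by apply: continuous_subspaceT => x; exact: cvg_snd.
Qed.

Lemma continuous_pair (T U W : topologicalType) (f : T -> U) (g : T -> W) :
  continuous f -> continuous g -> continuous (fun x => (f x, g x)).
Proof. by move=> cf cg x; exact: (cvg_pair (cf x) (cg x)). Qed.

Lemma within_continuous_comp (T U W : topologicalType) (P : set T) (Q : set U)
    (f : T -> U) (g : U -> W) :
  (forall x, P x -> Q (f x)) ->
  {within P, continuous f} -> {within Q, continuous g} ->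
  {within P, continuous (g \o f)}.
Proof.
move=> PQ /subspace_continuousP cf /subspace_continuousP cg.
apply/subspace_continuousP => x Px.
apply: (@cvg_comp _ _ _ f g _ (within Q (nbhs (f x)))); last exact/cg/PQ.
move=> S; rewrite /within /= => fS; have := cf x Px _ fS.
rewrite nbhs_simpl /within /=.
by apply: (@filterS _ (nbhs x)) => y /= + Py; apply => //; exact: PQ.
Qed.

Lemma strong_deformation_retract_trans A B C :
  strong_deformation_retract A B -> strong_deformation_retract B C ->
  strong_deformation_retract A C.
Proof.
move=> [BA [H [cH HA HB H1 Hid]]] [CB [K [cK KB KC K1 Kid]]].
split; first exact: subset_trans CB BA.
have min01 (t : R) : 0 <= t <= 1 -> 0 <= Num.min 1 (2 * t) <= 1.
  by move=> ?; rewrite minEle; case: ifP => ?; lra.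
have max01 (t : R) : 0 <= t <= 1 -> 0 <= Num.max 0 (2 * t - 1) <= 1.
  by move=> ?; rewrite maxEle; case: ifP => ?; lra.
have in01 (t : R) : [set` `[0, 1]%R] t <-> 0 <= t <= 1.
  by rewrite /= in_itv.
(* On either half of [0, 1] one of the first two summands equals the third, so
   this is the concatenation of [K] after [H], written without case analysis. *)
pose L (p : R * V) := H (Num.max 0 (2 * p.1 - 1), p.2)
  + K (Num.min 1 (2 * p.1), H (0, p.2)) - H (0, p.2).
have LE (t : R) x : 0 <= t <= 1 -> A x ->
    L (t, x) = (if t <= 2^-1 then K (2 * t, H (0, x)) else H (2 * t - 1, x)).
  move=> t01 Ax; rewrite /L /=; case: ifP => tle.
    rewrite max_l; last by lra.
    rewrite min_r; last by lra.
    by rewrite addrAC subrr add0r.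
  rewrite max_r; last by lra.
  rewrite min_l; last by lra.
  by rewrite K1 ?addrK//; exact: HB.
exists L; split.
- have c2 : continuous (fun p : (R * V)%type => 2 * p.1 : R).
    by move=> p; apply: cvgM; [exact: cvg_cst|exact: cvg_fst].
  have cH0 : {within cylinder A, continuous (fun p : R * V => H (0, p.2))}.
    apply: (@within_continuous_comp _ _ _ _ (cylinder A) (fun p : R * V => (0, p.2)) H) => //.
      by move=> p [_ Ap]; split => //; apply/in01; rewrite lexx ler01.
    by apply: continuous_subspaceT; apply: continuous_pair => q;
      [exact: cvg_cst|exact: cvg_snd].
  have cH1 : {within cylinder A,
      continuous (fun p : R * V => H (Num.max 0 (2 * p.1 - 1), p.2))}.
    apply: (@within_continuous_comp _ _ _ _ (cylinder A)
      (fun p : R * V => (Num.max 0 (2 * p.1 - 1), p.2)) H) => //.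
      by move=> q [/in01 q1 Aq]; split => //; apply/in01/max01.
    apply: continuous_subspaceT; apply: continuous_pair => q; last exact: cvg_snd.
    apply: (@continuous_max _ _ (fun=> 0) (fun p : R * V => 2 * p.1 - 1)); first exact: cvg_cst.
    by apply: cvgB; [exact: c2|exact: cvg_cst].
  have cK0 : {within cylinder A,
      continuous (fun p : R * V => K (Num.min 1 (2 * p.1), H (0, p.2)))}.
    apply: (@within_continuous_comp _ _ _ _ (cylinder B)
        (fun p : R * V => (Num.min 1 (2 * p.1), H (0, p.2))) K) => //.
      by move=> q [/in01 q1 Aq]; split; [apply/in01/min01|exact: HB].
    apply: (@continuous_pair (subspace (cylinder A))); last exact: cH0.
    have cm : continuous (fun p : (R * V)%type => Num.min 1 (2 * p.1) : R).
      by move=> u; apply: (@continuous_min _ _ (fun=> 1) (fun p : R * V => 2 * p.1)); [exact: cvg_cst|exact: c2].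
    exact: (continuous_subspaceT (A := cylinder A) cm).
  move=> p; apply: cvgB; last exact: cH0.
  by apply: cvgD; [exact: cH1|exact: cK0].
- move=> t x /in01 t01 Ax; rewrite LE//; case: ifP => tle.
    by apply/BA/KB; [apply/in01; lra|exact: HB].
  by apply: HA => //; apply/in01; lra.
- move=> x Ax; rewrite LE ?lexx ?ler01// invr_ge0 ler0n mulr0.
  by apply: KC; exact: HB.
- move=> x Ax; rewrite LE ?lexx ?ler01// ifF; last by apply/negbTE; lra.
  by rewrite (_ : 2 * 1 - 1 = 1) ?H1//; lra.
- move=> t x /in01 t01 Cx; have Bx := CB _ Cx; have Ax := BA _ Bx.
  rewrite LE// Hid//; last by apply/in01; rewrite lexx ler01.
  by case: ifP => tle; [rewrite Kid//|rewrite Hid//]; apply/in01; lra.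
Qed.

Lemma strong_deformation_retract_equivalent A B :
  strong_deformation_retract A B -> homotopy_equivalent A B.
Proof.
move=> [BA [H [cH HA HB H1 Hid]]].
exists (fun x => H (0, x)), id.
have z01 : [set` `[0, 1]%R] (0 : R) by rewrite /= in_itv /= lexx ler01.
split.
  apply: (@within_continuous_comp _ _ _ _ (cylinder A) (fun x : V => (0 : R, x)) H) => //.
  by apply: continuous_subspaceT; apply: continuous_pair => q;
    [exact: cst_continuous|exact: cvg_id].
split; first by move=> _ [x Ax <-]; exact: HB.
split; first by apply: continuous_subspaceT => x; exact: cvg_id.
split; first by move=> _ [x Bx <-]; exact: BA.
split; first by exists H.
exists snd; split; first by apply: continuous_subspaceT => x; exact: cvg_snd.
by split=> [t x _ //|]; split=> x Bx //=; rewrite Hid.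
Qed.

(** The homotopy is the straight-line one between [r] and the identity. It suits a radial push,
    where each point and its image lie in a common convex piece of [A]. *)
Lemma retraction_strong_deformation_retract A B (r : V -> V) :
  B `<=` A -> {within A, continuous r} ->
  (forall (t : R) x, 0 <= t <= 1 -> A x -> A ((1 - t) *: r x + t *: x)) ->
  (forall x, A x -> B (r x)) -> (forall x, B x -> r x = x) ->
  strong_deformation_retract A B.
Proof.
move=> BA cr segA rB rid; split=> //.
exists (fun p => (1 - p.1) *: r p.2 + p.1 *: p.2); split.
- move=> p; apply: cvgD.
    apply: cvgZ.
      have c1 : continuous (fun p : (R * V)%type => 1 - p.1 : R).
        by move=> q; apply: cvgB; [exact: cvg_cst|exact: cvg_fst].
      exact: (continuous_subspaceT (A := cylinder A) c1).
    apply: (@within_continuous_comp _ _ _ _ A snd r) => //; first by move=> ? [].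
    by apply: continuous_subspaceT => q; exact: cvg_snd.
  have c2 : continuous (fun p : (R * V)%type => p.1 *: p.2).
    by move=> q; apply: cvgZ; [exact: cvg_fst|exact: cvg_snd].
  exact: (continuous_subspaceT (A := cylinder A) c2).
- by move=> t x; rewrite /= in_itv /= => t01 Ax; exact: segA.
- by move=> x Ax /=; rewrite subr0 scale1r scale0r addr0; exact: rB.
- by move=> x Ax /=; rewrite subrr scale0r add0r scale1r.
- by move=> t x _ Bx /=; rewrite rid// -scalerDl subrK scale1r.
Qed.

End Deformation.
(** Stated for a transitive relation so that it serves both for inclusion of cells, in either
    direction, and for constraints compared by a real ratio, where ties occur. *)
Lemma finite_set_minimal (T : eqType) (le : T -> T -> Prop) (A : set T) :
  (forall x y z, le x y -> le y z -> le x z) -> finite_set A -> A !=set0 ->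
  exists2 m, A m & forall x, A x -> le x m -> le m x.
Proof.
move=> le_trans /finite_seqP[s ->] [x0 /= sx0].
elim: s x0 sx0 => [//|x s IH] _ _.
case: s IH => [_|y s IH]; first by exists x => [|z] /=; rewrite inE ?eqxx => // /eqP ->.
have [|m /= sm mmin] := IH y; first by rewrite /= inE eqxx.
have [xm|xm] := pselect (le x m).
  exists x => /=; first by rewrite inE eqxx.
  move=> z /=; rewrite inE => /predU1P[-> //|sz] zx.
  by apply: (le_trans _ _ _ xm); apply: mmin => //; exact: (le_trans _ _ _ zx xm).
exists m => /=; first by rewrite inE sm orbT.
by move=> z /=; rewrite inE => /predU1P[->|sz] //; exact: mmin.
Qed.

(** * Polyhedra: rays, proper faces and relatively interior points *)

Section Polyhedra.
Set Implicit Arguments.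
Unset Strict Implicit.
Variables (R : realType) (n : nat).
Local Notation V := 'rV[R]_n.
Implicit Types (u x y d q : V) (s : seq (V * R)%type) (P G : set V).

Lemma dotvDr u x y : dotv u (x + y) = dotv u x + dotv u y.
Proof. by rewrite /dotv -big_split /=; apply: eq_bigr => i _; rewrite mxE mulrDr. Qed.

Lemma dotvZr u k x : dotv u (k *: x) = k * dotv u x.
Proof. by rewrite /dotv mulr_sumr; apply: eq_bigr => i _; rewrite mxE mulrCA. Qed.

Lemma dotvBr u x y : dotv u (x - y) = dotv u x - dotv u y.
Proof. by rewrite dotvDr -scaleN1r dotvZr mulN1r. Qed.

Lemma dotvNl u x : dotv (- u) x = - dotv u x.
Proof. by rewrite /dotv -sumrN; apply: eq_bigr => i _; rewrite mxE mulNr. Qed.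

Lemma dotv_continuous u : continuous (dotv u : V -> R).
Proof.
apply: continuous_big => [|i _ x]; first exact: add_continuous.
by apply: (@cvgM _ _ (nbhs x) _ (fun=> u ord0 i) (fun v : V => v ord0 i));
  [exact: cvg_cst|exact: coord_continuous].
Qed.

Lemma closed_halfspace u beta : closed (halfspace u beta).
Proof.
apply: (@preimage_closed _ _ (dotv u : V -> R) [set z | z <= beta]).
  by move=> x _; exact: dotv_continuous.
exact: closed_le.
Qed.

Lemma polyhedral_closed P : polyhedral P -> closed P.
Proof.
move=> [s [_ ->]].
rewrite (_ : [set x | _] = \bigcap_(h in [set` s]) halfspace h.1 h.2).
  by apply: closed_bigI => h _; exact: closed_halfspace.
by apply/seteqP; split=> x /= sx h; exact: sx.
Qed.

Lemma dotv_conv u x y (t : R) :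
  dotv u ((1 - t) *: x + t *: y) = (1 - t) * dotv u x + t * dotv u y.
Proof. by rewrite dotvDr !dotvZr. Qed.

Lemma polyhedral_convex P x y (t : R) :
  polyhedral P -> P x -> P y -> 0 <= t <= 1 -> P ((1 - t) *: x + t *: y).
Proof.
move=> [s [_ ->]] Px Py t01 h sh.
have := Px h sh; have := Py h sh; rewrite /halfspace /= dotv_conv => ? ?.
nra.
Qed.

(** This is the ratio test of linear programming. Only constraints that increase along [d] can stop
    the ray, and the one with the least ratio of slack to speed is met first. *)
Lemma polyhedron_exit P s x d :
  P = [set x | forall h, h \in s -> halfspace h.1 h.2 x] -> P x ->
  (forall t : R, 0 <= t -> P (x + t *: d)) \/
  exists (t : R) h, [/\ 0 <= t, h \in s, 0 < dotv h.1 d,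
    dotv h.1 (x + t *: d) = h.2 & P (x + t *: d)].
Proof.
move=> PE Px; pose A : set (V * R)%type := [set h | h \in s /\ 0 < dotv h.1 d].
have sP h : h \in s -> dotv h.1 x <= h.2 by move: Px; rewrite PE; apply.
have [[h0 Ah0]|A0] := pselect (A !=set0); last first.
  left=> t t0; rewrite PE => h sh; rewrite /halfspace /= dotvDr dotvZr.
  have := sP h sh; suff : dotv h.1 d <= 0 by nra.
  by rewrite leNgt; apply/negP => hd; apply: A0; exists h.
pose ratio (h : V * R) := (h.2 - dotv h.1 x) / dotv h.1 d.
have [|||h [sh hd] hmin] :=
  @finite_set_minimal _ (fun h k => ratio h <= ratio k) A.
- by move=> ? ? ?; exact: le_trans.
- by apply: (@sub_finite_set _ _ [set` s]) => [h []//|]; exact: finite_seq.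
- by exists h0.
right; exists (ratio h), h.
have r0 : 0 <= ratio h by rewrite divr_ge0 ?subr_ge0 ?sP// ltW.
split=> //; first by rewrite dotvDr dotvZr divfK ?gt_eqF//; lra.
rewrite PE => k sk; rewrite /halfspace /= dotvDr dotvZr.
have [kd|kd] := leP (dotv k.1 d) 0; first by have := sP k sk; nra.
have : ratio h <= ratio k.
  by case/orP: (le_total (ratio h) (ratio k)) => // kh; exact: (hmin k (conj sk kd)).
by rewrite {2}/ratio ler_pdivlMr// => ?; lra.
Qed.

Lemma tight_face P s h x :
  P = [set x | forall h, h \in s -> halfspace h.1 h.2 x] ->
  (forall h, h \in s -> h.1 != 0) -> h \in s -> P x -> dotv h.1 x = h.2 ->
  face P (P `&` hyperplane h.1 h.2).
Proof.
move=> PE s0 sh Px hx; right; right; exists h.1, h.2; split; first exact: s0.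
split; first by exists x.
by split=> //; left; rewrite PE => y; exact.
Qed.

(** Take [y] in [P] off the supporting hyperplane. Moving from [x] directly away from [y] crosses
    that hyperplane and leaves [P] at once, so the exit time is zero. The blocking constraint is
    then tight at [x], and strict at [y] because it increases along [x - y]. *)
Lemma proper_face_tight P s G x :
  P = [set x | forall h, h \in s -> halfspace h.1 h.2 x] ->
  face P G -> G <> P -> G x ->
  exists h y, [/\ h \in s, dotv h.1 x = h.2, P y & dotv h.1 y < h.2].
Proof.
move=> PE [->//|[//|[u [beta [_ [_ [side ->]]]]]]] GP [Px xH].
have [y [Py yH]] : exists y, P y /\ dotv u y <> beta.
  apply: contrapT => noy; apply: GP; apply/seteqP; split=> [z []//|z Pz].
  by split=> //; apply: contrapT => zH; apply: noy; exists z.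
have nobeyond (t : R) : 0 < t -> ~ P (x + t *: (x - y)).
  move=> t0 Pz; move: xH; rewrite /hyperplane /= => xH.
  case: side => sub; have := sub _ Pz; have := sub _ Py; rewrite /halfspace /=;
    rewrite ?dotvNl dotvDr dotvZr dotvBr xH => ? ?; apply: yH; nra.
have [stay|[t [h [t0 sh hd ht Pt]]]] := polyhedron_exit (x - y) PE Px.
  by case: (nobeyond 1 ltr01); exact: stay.
have t00 : t = 0.
  apply/eqP; rewrite eq_le t0 andbT leNgt; apply/negP => /nobeyond; exact.
exists h, y; split=> //; move: ht hd; rewrite t00 scale0r addr0 dotvBr => ->; lra.
Qed.

(** The point [q] is relatively interior: it is strict in every constraint that is not an equality
    on all of [P]. Each new constraint is handled by moving [q] slightly towards a point where it is
    strict, which preserves the earlier strict inequalities. *)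
Lemma polyhedral_slack_point P s u (k : R) x :
  polyhedral P -> (forall h y, h \in s -> P y -> dotv h.1 y <= h.2) ->
  P x -> k < dotv u x ->
  exists q, [/\ P q, k < dotv u q &
    forall h y, h \in s -> P y -> dotv h.1 y < h.2 -> dotv h.1 q < h.2].
Proof.
move=> Ppoly; elim: s => [|h s IH] sP Px ux; first by exists x.
have [||//|q [Pq uq qs]] := IH; first by move=> g y sg; apply: sP; rewrite inE sg orbT.
  exact: Px.
have [[y [Py hy]]|noy] := pselect (exists y, P y /\ dotv h.1 y < h.2); last first.
  exists q; split=> // g y; rewrite inE => /predU1P[->|]; last exact: qs.
  by move=> Py hy; exfalso; apply: noy; exists y.
pose M := `|dotv u y - dotv u q|; pose D := dotv u q - k.
have M0 : 0 <= M by exact: normr_ge0.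
have D0 : 0 < D by rewrite subr_gt0.
have N0 : 0 < D + M + 1 by lra.
(* The move costs at most [e * M] in the value of [dotv u], which must stay below the margin [D].
   The summand 1 keeps [e] below 1 even when [M] is 0. *)
pose e := D / (D + M + 1).
have e0 : 0 < e by rewrite divr_gt0.
have e1 : e < 1 by rewrite ltr_pdivrMr//; lra.
have eM : e * M < D by rewrite mulrAC ltr_pdivrMr//; nra.
exists ((1 - e) *: q + e *: y); split.
- by apply: polyhedral_convex => //; lra.
- rewrite dotv_conv.
  have : - M <= dotv u y - dotv u q by rewrite lerNl ler_normr lexx orbT.
  rewrite /D in eM *; move=> ?; nra.
- move=> g z; rewrite dotv_conv inE => /predU1P[-> Pz hz|sg Pz gz].
    have := sP h q; rewrite inE eqxx => /(_ isT Pq) ?; nra.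
  have := qs g z sg Pz gz; have := sP g y; rewrite inE sg orbT => /(_ isT Py) ? ?; nra.
Qed.

End Polyhedra.

(** * Maxima of finite families of real functions *)

Section BigMax.
Set Implicit Arguments.
Unset Strict Implicit.
Variable R : realType.

Lemma continuous_bigmax_seq (T : topologicalType) (I : Type) (r : seq I)
    (f0 : T -> R) (f : I -> T -> R) :
  continuous f0 -> (forall i, continuous (f i)) ->
  continuous (fun x => \big[Num.max/f0 x]_(i <- r) f i x).
Proof.
move=> cf0 cf; elim: r => [|i r IH].
  by rewrite (_ : (fun x => _) = f0)//; apply/funext => x; rewrite big_nil.
pose g x := \big[Num.max/f0 x]_(i <- r) f i x.
rewrite (_ : (fun x => _) = (fun x => Num.max (f i x) (g x))).
  by move=> x; apply: (@continuous_max _ _ (f i) g); [exact: cf|exact: IH].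
by apply/funext => x; rewrite big_cons.
Qed.

Lemma bigmax_seq_geP (I : eqType) (r : seq I) (f : I -> R) (x0 g : R) :
  g <= \big[Num.max/x0]_(i <- r) f i -> g <= x0 \/ exists2 i, i \in r & g <= f i.
Proof.
elim: r => [|i r IH]; first by rewrite big_nil; left.
rewrite big_cons le_max => /orP[gi|/IH[|[j rj gj]]]; [right|by left|right].
  by exists i => //; rewrite inE eqxx.
by exists j => //; rewrite inE rj orbT.
Qed.

End BigMax.

(** * Radial projection away from an interior point *)

Section RadialProjection.
Set Implicit Arguments.
Unset Strict Implicit.
Variables (R : realType) (n : nat).
Local Notation V := 'rV[R]_n.
Variables (s : seq (V * R)%type) (u q : V) (a c : R).
Implicit Types x y : V.

(* The term of [h] is [0] when [q] lies on the boundary of [h], since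
   division by [0] gives [0]; such constraints do not matter because the first
   two terms of the maximum keep the gauge positive. *)
Definition radial_gauge x : R :=
  Num.min 1 (\big[Num.max/Num.max ((dotv u q - c) / (dotv u q - a))
                                  (dotv u (q - x) / (dotv u q - a))]_(h <- s)
    (dotv h.1 (x - q) / (h.2 - dotv h.1 q))).

(** The terms of [s] in the gauge form the Minkowski gauge of the polyhedron centred at [q], and the
    term in [u] is that of the half-space where [dotv u] is at least [a]. The constant is the value
    of the [u] term at level [c], so at or below that level it never exceeds it. The cap at 1
    prevents points from being pulled back towards [q]. *)
Definition radial_projection x : V := q + (radial_gauge x)^-1 *: (x - q).

Hypothesis ac : a <= c.
Hypothesis uq : c < dotv u q.

Lemma radial_gauge_gt0 x : 0 < radial_gauge x.
Proof.
rewrite /radial_gauge lt_min ltr01 /=.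
apply: (lt_le_trans _ (bigmax_ge_id _ _ _ _)).
by rewrite lt_max divr_gt0// subr_gt0//; exact: le_lt_trans ac uq.
Qed.

Lemma radial_gauge_le1 x : radial_gauge x <= 1.
Proof. by rewrite /radial_gauge ge_min lexx. Qed.

Lemma radial_projection_continuous : continuous radial_projection.
Proof.
have cbig : continuous radial_gauge.
  have cdiv v k : continuous (fun x : V => dotv v (x - q) / k).
    move=> x; apply: (@cvgM _ _ (nbhs x) _ (fun y => dotv v (y - q)) (fun=> k^-1));
      last exact: cvg_cst.
    rewrite (_ : (fun y => dotv v (y - q)) = (fun y => dotv v y - dotv v q)).
      by rewrite dotvBr; apply: cvgB; [exact: dotv_continuous|exact: cvg_cst].
    by apply/funext => y; rewrite dotvBr.
  have cdiv' v k : continuous (fun x : V => dotv v (q - x) / k).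
    rewrite (_ : (fun x => _) = (fun x => - (dotv v (x - q) / k))).
      by move=> x; apply: (@cvgN _ _ _ (nbhs x) _ (fun y => dotv v (y - q) / k)); exact: cdiv.
    by apply/funext => y; rewrite -mulNr -mulN1r -dotvZr scaleN1r opprB.
  move=> x; apply: (@continuous_min _ _ (fun=> 1)); first exact: cst_continuous.
  apply: continuous_bigmax_seq => [|h]; last exact: cdiv.
  move=> y; apply: (@continuous_max _ _ (fun=> (dotv u q - c) / (dotv u q - a))
    (fun x => dotv u (q - x) / (dotv u q - a))); last exact: cdiv'.
  exact: cst_continuous.
move=> x; apply: (@cvgD _ _ _ (nbhs x) _ (fun=> q)
  (fun y => (radial_gauge y)^-1 *: (y - q))); first exact: cvg_cst.
apply: (@cvgZ _ _ _ (nbhs x) _ (fun y => (radial_gauge y)^-1) (fun y => y - q)).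
  apply: (@cvgV _ _ (nbhs x) _ radial_gauge); last exact: cbig.
  by rewrite gt_eqF// radial_gauge_gt0.
by apply: (@cvgB _ _ _ (nbhs x) _ id (fun=> q)); [exact: cvg_id|exact: cvg_cst].
Qed.

Lemma dotv_radial v x :
  dotv v (radial_projection x) = dotv v q + dotv v (x - q) / radial_gauge x.
Proof. by rewrite {1}/radial_projection dotvDr dotvZr mulrC. Qed.

Lemma dotv_radial_le x : dotv u x <= c ->
  dotv u (radial_projection x) <= dotv u x.
Proof.
move=> xc; rewrite dotv_radial dotvBr -lerBrDl ler_pdivrMr ?radial_gauge_gt0//.
have := radial_gauge_le1 x; have := uq; nra.
Qed.

Lemma radial_gauge_eq1 x :
  dotv u x <= a \/ (exists h, [/\ h \in s, dotv h.1 q < h.2 & dotv h.1 x = h.2]) ->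
  radial_gauge x = 1.
Proof.
move=> xb; apply/min_idPl; case: xb => [xa|[h [sh hq hx]]].
  apply: (le_trans _ (bigmax_ge_id _ _ _ _)).
  have uqa : 0 < dotv u q - a by have := uq; have := ac; lra.
  by rewrite le_max dotvBr [X in _ || X]ler_pdivlMr ?mul1r ?lerB ?orbT.
apply: (le_trans _ (le_bigmax_seq _ h _ _ sh isT)).
by rewrite /= dotvBr hx divff// subr_eq0 gt_eqF.
Qed.

Lemma radial_projection_id x :
  dotv u x <= a \/ (exists h, [/\ h \in s, dotv h.1 q < h.2 & dotv h.1 x = h.2]) ->
  radial_projection x = x.
Proof.
by move=> xb; rewrite /radial_projection radial_gauge_eq1// invr1 scale1r addrC subrK.
Qed.

Variable P : set V.
Hypothesis PE : P = [set x | forall h, h \in s -> halfspace h.1 h.2 x].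
Hypothesis Pq : P q.
Hypothesis q_slack : forall h y, h \in s -> P y -> dotv h.1 y < h.2 ->
  dotv h.1 q < h.2.

Lemma radial_projection_in x : P x -> P (radial_projection x).
Proof.
move=> Px; rewrite PE => h sh; rewrite /halfspace /= dotv_radial.
have hx : dotv h.1 x <= h.2 by move: Px; rewrite PE; apply.
have g0 := radial_gauge_gt0 x.
(* If [h] is tight at [q], then [q_slack] makes it an equality on [P], hence constant along the ray.
   Otherwise its term is at most 1 because [x] is in [P], so the capped gauge still dominates it. *)
have [hq|hq] := ltP (dotv h.1 q) h.2; last first.
  have hxe : dotv h.1 x = h.2.
    apply/eqP; rewrite eq_le hx /= leNgt; apply/negP => lt.
    by have := q_slack sh Px lt; rewrite ltNge hq.
  have hqe : dotv h.1 q <= h.2 by move: Pq; rewrite PE; apply.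
  rewrite -lerBrDl ler_pdivrMr// dotvBr hxe; nra.
rewrite -lerBrDl ler_pdivrMr// -ler_pdivrMl ?subr_gt0// mulrC.
rewrite le_min ler_pdivrMr ?subr_gt0// mul1r dotvBr lerB//=.
by rewrite -dotvBr; exact: (le_bigmax_seq _ h _ _ sh isT).
Qed.

Lemma radial_projection_hits x : P x -> dotv u x <= c ->
  dotv u (radial_projection x) <= a \/
  exists h, [/\ h \in s, dotv h.1 q < h.2 & dotv h.1 (radial_projection x) = h.2].
Proof.
move=> Px xc; have Py := radial_projection_in Px; have g0 := radial_gauge_gt0 x.
have uqa : 0 < dotv u q - a by have := uq; have := ac; lra.
(* Unfolding only the right-hand side extracts a term of the maximum that is at least the gauge. A
   [u] term or the constant gives level [a]; a term of [s] gives a tight constraint. *)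
have : radial_gauge x <= radial_gauge x by [].
rewrite {2}/radial_gauge le_min => /andP[_ /bigmax_seq_geP[|[h sh]]].
  rewrite le_max => gle; left; rewrite dotv_radial dotvBr -lerBrDl.
  rewrite ler_pdivrMr//.
  have {gle} : radial_gauge x <= dotv u (q - x) / (dotv u q - a).
    case/orP: gle => // /le_trans; apply.
    by rewrite ler_pM2r ?invr_gt0// dotvBr lerB.
  rewrite ler_pdivlMr// dotvBr; lra.
move=> gle; right; exists h.
have hq : dotv h.1 q <= h.2 by move: Pq; rewrite PE; apply.
(* Were [h] tight at [q], division by zero would make its term 0, below the positive gauge. *)
have hq' : dotv h.1 q < h.2.
  rewrite lt_neqAle hq andbT; apply/eqP => hqe.
  by move: gle; rewrite hqe subrr invr0 mulr0 leNgt g0.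
split=> //; apply/eqP; rewrite eq_le; apply/andP; split.
  by move: Py; rewrite PE; apply.
rewrite dotv_radial -lerBlDl ler_pdivlMr// mulrC -ler_pdivlMr ?subr_gt0//.
Qed.

End RadialProjection.

(** * Collapsing a polyhedral complex cell by cell *)

Section Complexes.
Set Implicit Arguments.
Unset Strict Implicit.
Variables (R : realType) (n : nat).
Local Notation V := 'rV[R]_n.
Variables (CC : set (set V)) (F : V -> R) (a b : R).
Hypothesis complexCC : polyhedral_complex CC.
Hypothesis affineF : cellwise_affine CC F.
Hypothesis transF : transversal_thresholds CC F a b.
Implicit Types (C D G : set V) (K : set (set V)).

(** Closedness is what allows the retraction to be pasted from its pieces. Subfamilies are allowed
    because one piece is a single cell and the other omits that cell. *)
Lemma closed_sublevel K c : K `<=` CC -> closed (sublevel K F c).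
Proof.
move=> KC; have [finCC [polyCC _]] := complexCC.
rewrite (_ : sublevel K F c = \bigcup_(C in K) (C `&` [set x | F x <= c])).
  apply: closed_bigcup => [|C KCC]; first exact: sub_finite_set KC finCC.
  have [u [beta Fu]] := affineF (KC _ KCC).
  rewrite (_ : _ `&` _ = C `&` halfspace u (c - beta)).
    exact: closedI (polyhedral_closed (polyCC _ (KC _ KCC))) (@closed_halfspace _ _ u _).
  apply/seteqP; split=> x [Cx]; rewrite /halfspace /= => Fx; split=> //=.
    by rewrite lerBrDr -Fu.
  by rewrite Fu// -lerBrDr.
apply/seteqP; split=> x; first by move=> [[C KCC Cx] Fx]; exists C.
by move=> [C KCC [Cx Fx]]; split=> //; exists C.
Qed.

(* A minimal cell among the faces of [C] that reach the value [F x0] must be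
   flat: otherwise one could move inside it in a direction of increase of [F]
   until hitting a smaller face. *)
Lemma cell_exceeds_threshold C x0 c :
  CC C -> C x0 -> a <= F x0 -> c <= b -> exists2 p, C p & c < F p.
Proof.
move=> CCC Cx0 aF cb; have [finCC [polyCC [faceCC _]]] := complexCC.
apply: contrapT => nop.
have Fc x : C x -> F x <= c.
  by move=> Cx; rewrite leNgt; apply/negP => cF; apply: nop; exists x.
pose A : set (set V) :=
  [set G | [/\ CC G, G `<=` C & exists2 x, G x & F x0 <= F x]].
have [|||G [CCG GC [x Gx Fx]] Gmin] :=
  @finite_set_minimal _ (fun G D : set V => G `<=` D) A.
- by move=> ? ? ?; exact: subset_trans.
- by apply: sub_finite_set finCC => G [].
- by exists C; split=> //; exists x0.
have le_const y z : G y -> G z -> F z <= F y.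
  move=> Gy Gz; rewrite leNgt; apply/negP => Fyz.
  have [u [beta Fu]] := affineF CCG; have [s [s0 GE]] := polyCC _ CCG.
  have ud : 0 < dotv u (z - y) by move: Fyz; rewrite !Fu// dotvBr; lra.
  (* The ray starts at [x], so that [F] stays at least [F x0] along it. If it never leaves [G], then
     at the time [t] chosen below [F] equals [c + 1], against the bound [c] on [C]. *)
  have [stay|[t [h [t0 sh hd ht Gt]]]] := polyhedron_exit (z - y) GE Gx.
    pose t := (c - F x + 1) / dotv u (z - y).
    have t0 : 0 <= t by rewrite divr_ge0 ?(ltW ud)//; have := Fc _ (GC _ Gx); lra.
    have Gt := stay t t0; have := Fc _ (GC _ Gt).
    rewrite Fu// dotvDr dotvZr /t divfK ?gt_eqF// Fu//; lra.
  have AG' : A (G `&` hyperplane h.1 h.2).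
    split; [|by move=> w [Gw _]; exact: GC|].
      by apply: faceCC CCG _; exact: (tight_face GE s0 sh Gt ht).
    exists (x + t *: (z - y)); first by split.
    apply: (le_trans Fx); rewrite !Fu// dotvDr dotvZr; nra.
  (* Minimality puts [y] and [z] on the hyperplane of [h], although [h] strictly increases along
     [z - y]. *)
  have sub := Gmin _ AG' (@subIsetl _ _ _).
  have [_] := sub _ Gy; have [_] := sub _ Gz; rewrite /hyperplane /= => hz hy.
  by move: hd; rewrite dotvBr hz hy subrr ltxx.
apply: transF; exists G; split.
  split=> //; split; first by exists x.
  by move=> y z Gy Gz; apply/eqP; rewrite eq_le !le_const.
move=> _ [y Gy <-]; rewrite /= in_itv /=.
have := le_const _ _ Gy Gx; have := Fc _ (GC _ Gy) => ? ?; lra.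
Qed.

(** Joining [sublevel CC F a] to both sides keeps the points at or below level [a] when their cells
    are removed. Since [K] is closed under faces, the proper faces of [C] survive the removal and
    receive the points pushed to the boundary. *)
Lemma collapse_maximal_cell K C c : a <= c -> c <= b -> K `<=` CC ->
  (forall D G, K D -> CC G -> G `<=` D -> K G) ->
  K C -> (forall D, K D -> C `<=` D -> D = C) ->
  strong_deformation_retract (sublevel CC F a `|` sublevel K F c)
    (sublevel CC F a `|` sublevel (K `\ C) F c).
Proof.
move=> ac cb KCC Kdown KC Cmax.
have [finCC [polyCC [faceCC interCC]]] := complexCC.
set A := (X in strong_deformation_retract X _).
set B := (X in strong_deformation_retract _ X).
pose Cc := C `&` [set x | F x <= c].
have AE : A = Cc `|` B.
  apply/seteqP; split=> x.
    move=> [Xa|[[D KD Dx] Fx]]; first by right; left.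
    have [DC|DC] := pselect (D = C); first by left; split=> //; rewrite -DC.
    by right; right; split=> //; exists D.
  move=> [[Cx Fx]|[Xa|[[D [KD _] Dx] Fx]]].
  - by right; split=> //; exists C.
  - by left.
  - by right; split=> //; exists D.
have BA : B `<=` A by rewrite AE => x Bx; right.
have [[x0 [Cx0 aF Fc]]|Clow] :=
    pselect (exists x, [/\ C x, a < F x & F x <= c]); last first.
  suff -> : A = B by exact: strong_deformation_retract_refl.
  apply/seteqP; split=> // x; rewrite AE => -[[Cx Fx]|//]; left.
  split; first by exists C => //; exact: KCC.
  by rewrite leNgt; apply/negP => aF; apply: Clow; exists x.
have CCC := KCC _ KC; have polyC := polyCC _ CCC; have [s [s0 CE]] := polyC.
have [u [beta Fu]] := affineF CCC.
have [p Cp cp] := cell_exceeds_threshold CCC Cx0 (ltW aF) cb.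
have [||||q [Cq uq qs]] := @polyhedral_slack_point _ _ C s u (c - beta) p.
- exact: polyC.
- by rewrite {1}CE => h y sh; exact.
- exact: Cp.
- by move: cp; rewrite Fu//; lra.
have acb : a - beta <= c - beta by rewrite lerB.
pose rho := radial_projection s u q (a - beta) (c - beta).
have leFu x k : C x -> (F x <= k) = (dotv u x <= k - beta).
  by move=> Cx; rewrite Fu// lerBrDr.
pose r x := if x \in C then rho x else x.
have rC x : C x -> r x = rho x by move=> Cx; rewrite /r mem_set.
have rhoC x : C x -> C (rho x) by exact: (radial_projection_in acb uq CE Cq qs).
have rhoF x : C x -> F x <= c -> F (rho x) <= F x.
  move=> Cx; rewrite leFu// => xc; rewrite !Fu ?lerD2r//; last exact: rhoC.
  exact: dotv_radial_le.
have rB x : B x -> r x = x.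
  move=> Bx; rewrite /r; case: ifPn => // /set_mem Cx; apply: radial_projection_id => //.
  case: Bx => [[_ Fx]|[[D [KD DC] Dx] Fx]]; first by left; rewrite -leFu.
  (* By maximality of [C], the cell [D] meets it in a proper face. A constraint tight at [x] and
     strict at [q] then makes the projection fix [x]. *)
  right; have [CD _] := interCC _ _ CCC (KCC _ KD).
  have [|h [y [sh hx Cy hy]]] := proper_face_tight CE CD _ (conj Cx Dx).
    move=> CDC; apply: DC; apply: Cmax => // z; rewrite -CDC => -[] //.
  by exists h; split=> //; exact: qs hy.
have rhoB x : Cc x -> B (rho x).
  move=> [Cx Fx]; have Cy := rhoC _ Cx; have Fy := le_trans (rhoF _ Cx Fx) Fx.
  have xc : dotv u x <= c - beta by rewrite -leFu.
  have [ya|[h [sh hq hy]]] := radial_projection_hits acb uq CE Cq qs Cx xc.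
    by left; split; [exists C|rewrite leFu].
  (* This face misses [q], so it is a cell of [K] different from [C]. *)
  right; split=> //; exists (C `&` hyperplane h.1 h.2); last by split.
  split; last by move=> GC; move: Cq; rewrite -GC => -[_ /= he]; move: hq; rewrite he ltxx.
  apply: (Kdown C) => //.
  by apply: faceCC CCC _; exact: (tight_face CE s0 sh Cy hy).
apply: (retraction_strong_deformation_retract BA _ _ _ rB).
(* Pasting over the closed sets [Cc] and [B], where [r] is [rho] and the identity respectively. *)
- rewrite AE; apply: withinU_continuous.
  + rewrite (_ : Cc = sublevel [set C] F c).
      by apply: closed_sublevel => _ ->.
    apply/seteqP; split=> x; first by move=> [Cx Fx]; split=> //; exists C.
    by move=> [[_ -> Cx] Fx].
  + by apply: closedU; apply: closed_sublevel => // D [/KCC].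
  + apply: (@subspace_eq_continuous _ _ _ rho) => [x|].
      by rewrite inE => -[Cx _]; rewrite /from_subspace rC.
    by apply: continuous_subspaceT; exact: radial_projection_continuous.
  + apply: (@subspace_eq_continuous _ B _ (fun x : V => x)) => [x|].
      by rewrite inE => Bx; rewrite /from_subspace rB.
    by apply: continuous_subspaceT => x; exact: cvg_id.
- move=> t x t01 Ax; have [[Cx Fx]|Bx] : (Cc `|` B) x by rewrite -AE.
    have Cy := rhoC _ Cx; rewrite rC// AE; left.
    have Cz := polyhedral_convex polyC Cy Cx t01; split=> //=.
    have := rhoF _ Cx Fx; rewrite Fu// (Fu _ Cz) (Fu _ Cx) dotv_conv.
    by move: Fx; rewrite /= (Fu _ Cx); nra.
  by rewrite rB// -scalerDl subrK scale1r.
- move=> x; rewrite AE => -[Ccx|Bx]; last by rewrite rB.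
  by rewrite rC; [exact: rhoB|case: Ccx].
Qed.

Lemma sublevel_strong_deformation_retract c : a <= c -> c <= b ->
  strong_deformation_retract (sublevel CC F c) (sublevel CC F a).
Proof.
move=> ac cb; have [finCC _] := complexCC.
(* Induction on a strict bound for the length of a list enumerating the remaining cells; the case
   [m = 0] is vacuous. *)
have H m K : K `<=` CC -> (forall D G, K D -> CC G -> G `<=` D -> K G) ->
    (exists2 s : seq (set V), K = [set` s] & (size s < m)%N) ->
    strong_deformation_retract (sublevel CC F a `|` sublevel K F c) (sublevel CC F a).
  elim: m K => [|m IH] K KCC Kdown [s Ks sm]; first by [].
  have [[C0 KC0]|K0] := pselect (K !=set0); last first.
    rewrite (_ : _ `|` _ = sublevel CC F a).
      exact: strong_deformation_retract_refl.
    apply/setUidl => x [[D KD _] _]; exfalso; apply: K0; by exists D.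
  have [|||C KC Cmax] := @finite_set_minimal _ (fun G D : set V => D `<=` G) K.
  - by move=> x y z yx zy; exact: subset_trans zy yx.
  - by apply: sub_finite_set finCC.
  - by exists C0.
  apply: strong_deformation_retract_trans.
    apply: (@collapse_maximal_cell K C) => // D KD CD.
    by apply/seteqP; split=> //; exact: Cmax.
  apply: IH.
  - by move=> D [/KCC].
  - move=> D G [KD DC] CCG GD; split; first exact: Kdown KD CCG GD.
    move=> GC; apply: DC; apply/seteqP; split; last by rewrite -GC.
    by apply: Cmax => //; rewrite -GC.
  (* The list may repeat cells; filtering drops every copy of [C], and at least one is present. *)
  - exists [seq D <- s | D != C].
      apply/seteqP; split=> D /=; rewrite mem_filter.
        by rewrite Ks => -[/= -> /eqP ->].
      by move=> /andP[/eqP DC sD]; split=> //; rewrite Ks.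
    rewrite -ltnS; apply: leq_trans sm; rewrite ltnS size_filter.
    rewrite -(count_predC (pred1 C)) addnC -addn1 leq_add2l.
    by rewrite -has_count has_pred1; move: KC; rewrite Ks.
have -> : sublevel CC F c = sublevel CC F a `|` sublevel CC F c.
  by apply/esym/setUidr => x [Cx Fx]; split=> //; exact: le_trans Fx ac.
have /finite_seqP[s sE] := finCC.
apply: (H (size s).+1) => //; last by exists s.
Qed.

End Complexes.

(** * Sublevel sets, and superlevel sets by a change of sign *)

Theorem theorem1p4 (R : realType) (n : nat) (CC : set (set 'rV[R]_n))
  (F : 'rV[R]_n -> R) (a b : R) :
  polyhedral_complex CC ->
  cellwise_affine CC F ->
  transversal_thresholds CC F a b ->
  forall c : R, a <= c <= b ->
    homotopy_equivalent (sublevel CC F c) (sublevel CC F a) /\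
    homotopy_equivalent (superlevel CC F c) (superlevel CC F b).
Proof.
move=> cplx affF transF c /andP[ac cb]; split.
  apply: strong_deformation_retract_equivalent.
  exact: (sublevel_strong_deformation_retract cplx affF transF).
have superE k : superlevel CC F k = sublevel CC (fun x => - F x) (- k).
  by apply/seteqP; split=> x [Cx Fx]; split=> //; move: Fx; rewrite lerN2.
rewrite !superE; apply: strong_deformation_retract_equivalent.
(* For [- F] the interval of transversal thresholds is [[- b, - a]], so [- b] becomes the lower end
   and [- a] the upper one. *)
apply: (@sublevel_strong_deformation_retract _ _ _ _ _ (- a)) => //; rewrite ?lerN2//.
  move=> C /affF[u [beta Fu]]; exists (- u), (- beta) => x Cx.
  by rewrite Fu// dotvNl opprD.
move=> [C [[CCC [C0 flatC]] Cab]]; apply: transF; exists C; split.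
  by split=> //; split=> // x y Cx Cy; apply: oppr_inj; exact: flatC.
move=> _ [x Cx <-]; have /= := Cab (- F x); rewrite !in_itv /= !lerN2 andbC; apply.
by exists x.
Qed.
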